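(* Let $L\ge 0$ be an integer and let $A,B,C,q$ be indeterminates. Let $D_L$ denote the set of all partitions $\tilde\pi$ into distinct parts, each part $\le L$ (including the empty partition), and let $\omega(\tilde\pi)$ be the weight of $\tilde\pi$ (a polynomial in $A,B,C$) defined in the context. Then $$\sum_{\tilde\pi\in D_L}\omega(\tilde\pi)\,q^{|\tilde\pi|}=\sum_{i,j,k\ge 0}q^{T_i+T_j+T_k}A^iB^jC^k\begin{bmatrix}L-i\\ j\end{bmatrix}_q\begin{bmatrix}L-j\\ k\end{bmatrix}_q\begin{bmatrix}L-k\\ i\end{bmatrix}_q,$$ where $|\tilde\pi|$ is the sum of the parts of $\tilde\pi$.
   Context: Notation: $T_n=\frac{n(n+1)}{2}$. For an integer $N\ge 0$, $(a)_N=(a;q)_N=\prod_{j=0}^{N-1}(1-aq^j)$ with $(a)_0=1$. The $q$-binomial coefficient is $\begin{bmatrix}n+m\\ n\end{bmatrix}_q=\frac{(q)_{n+m}}{(q)_n(q)_m}$ if $n,m\ge 0$, and $0$ otherwise; i.e. $\begin{bmatrix}M\\ n\end{bmatrix}_q=0$ unless $0\le n\le M$. Weights: Partitions have positive integer parts. A partition $\tilde\pi$ into distinct parts is decomposed into chains $\chi$, a chain being a maximal run of consecutive integers among the parts of $\tilde\pi$. For a chain $\chi$, let $l=l(\chi)$ be its length (number of parts) and $s(\chi)$ its smallest part. The weight of $\tilde\pi$ is $\omega(\tilde\pi)=\prod_{\chi}\omega(\chi)$, the product over all chains $\chi$ of $\tilde\pi$ (so the empty partition has weight $1$). The weight of a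 chain $\chi$ of length $l$ is $$\omega(\chi)=\sum_{i+j+k=l}A^iB^jC^k+ABC\sum_{i+j+k=l-2}A^iB^jC^k\quad\text{if } s(\chi)=1,$$ $$\omega(\chi)=F_l(A,B,C)+A(B+C)F_{l-1}(A,B,C)+A^2BC\,F_{l-2}(A,B,C)\quad\text{if } s(\chi)>1,$$ where $$F_l(A,B,C)=\sum_{i+j+k=l}A^iB^jC^k+ABC\sum_{i+j+k=l-2}A^iB^jC^k+BC\sum_{j+k=l-1}B^jC^k.$$ In all these sums the summation variables are integers $\ge 0$ (so a sum with a negative prescribed total is empty, equal to $0$). *)

(* Defs.v *)
From HB Require Import structures.
From mathcomp Require Import all_boot all_order all_algebra.
From mathcomp Require Import boolp classical_sets functions cardinality fsbigop.
From mathcomp Require Import mpoly.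

Set Implicit Arguments.
Unset Strict Implicit.
Unset Printing Implicit Defensive.

Import Order.TTheory GRing.Theory Num.Theory.
Local Open Scope ring_scope.

Definition ratfun : fieldType := {fraction {mpoly int[4]}}.
Definition varA : ratfun := tofrac 'X_(Ordinal (isT : (0 < 4)%N)).
Definition varB : ratfun := tofrac 'X_(Ordinal (isT : (1 < 4)%N)).
Definition varC : ratfun := tofrac 'X_(Ordinal (isT : (2 < 4)%N)).
Definition varq : ratfun := tofrac 'X_(Ordinal (isT : (3 < 4)%N)).

Definition tri (n : nat) : nat := ((n * n.+1) %/ 2)%N.

Definition qpoch (K : fieldType) (a q : K) (N : nat) : K :=
  \prod_(j < N) (1 - a * q ^+ j).

(* [M choose n]_q with M = n + m. The arguments are signed because the upper
   index may be a negative difference, where truncated subtraction would be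
   wrong. *)
Definition qbinom (K : fieldType) (q : K) (M n : int) : K :=
  match n, M - n with
  | Posz n', Posz m' => qpoch q q (n' + m') / (qpoch q q n' * qpoch q q m')
  | _, _ => 0
  end.

Section Weights.

Variables (R : comNzRingType) (A B C : R).

(* The prescribed totals m are signed, so that l - 1 and l - 2 are not
   truncated; for m < 0 no index satisfies the condition. *)
Definition sum_ijk (m : int) : R :=
  \sum_(i < `|m|.+1) \sum_(j < `|m|.+1)
     \sum_(k < `|m|.+1 | (i + j + k)%N%:Z == m) A ^+ i * B ^+ j * C ^+ k.

Definition sum_jk (m : int) : R :=
  \sum_(j < `|m|.+1) \sum_(k < `|m|.+1 | (j + k)%N%:Z == m) B ^+ j * C ^+ k.

Definition Fpoly (l : int) : R :=
  sum_ijk l + A * B * C * sum_ijk (l - 2) + B * C * sum_jk (l - 1).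

Definition chain_weight (s l : nat) : R :=
  if s == 1%N then sum_ijk l%:Z + A * B * C * sum_ijk (l%:Z - 2)
  else Fpoly l%:Z + A * (B + C) * Fpoly (l%:Z - 1)
       + A ^+ 2 * B * C * Fpoly (l%:Z - 2).

(* The integers s, s + 1, ..., s + l - 1 form a maximal run in p; the predecessor
   s.-1 is meant for s > 0. *)
Definition is_chain (p : seq nat) (s l : nat) : bool :=
  [&& (0 < l)%N, all (mem p) (iota s l), s.-1 \notin p & (s + l)%N \notin p].

(* A chain is given by its smallest part s and its length l, so the product
   ranges over the pairs (s, l) that describe a chain of p. *)
Definition weight (p : seq nat) : R :=
  \prod_(s <- p) \prod_(1 <= l < (size p).+1 | is_chain p s l)
     chain_weight s l.

End Weights.

(* Partitions into distinct parts are listed in strictly decreasing order. *)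
Definition distinct_partition (p : seq nat) : bool :=
  sorted gtn p && all (leq 1) p.

Definition distinct_partitions_le (L : nat) : set (seq nat) :=
  [set p | distinct_partition p /\ all (geq L) p]%classic.

(* Main.v *)
Require Import Defs.
From HB Require Import structures.
From mathcomp Require Import all_boot all_order all_algebra.
From mathcomp Require Import boolp classical_sets functions cardinality fsbigop.
From mathcomp Require Import mpoly.
From mathcomp Require Import ring zify.

Set Implicit Arguments.
Unset Strict Implicit.
Unset Printing Implicit Defensive.

Import Order.TTheory GRing.Theory Num.Theory.
Local Open Scope ring_scope.

(** Both sides satisfy one and the same recurrence of order four in [L], which
    determines a sequence completely.

    On the side of partitions, the weights have rational generating functions
    in the length of the chain: with h(x) = 1 / ((1-Ax)(1-Bx)(1-Cx)), a chain
    that starts at 1 has the generating function (1 + ABC x^2) h(x), and the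
    bulky definition of the other weights collapses to the product
    (1+ABx)(1+ACx)(1+BCx) h(x) ([upper_weightE]). Splitting off the chain that
    contains [L] expresses the sum G_L over D_L as a sum over the length l of
    that chain, with the factor q^(T_L - T_(L-l)) and the remaining sum
    G_(L-l-1). After division by q^(T_L) this is a convolution
    ([partition_sum_conv]), so multiplying by (1-Ax)(1-Bx)(1-Cx) leaves a
    relation with finitely many terms. With e1, e2, e3 the elementary symmetric
    polynomials of A, B, C it reads
      G_L = (1 + e1 q^L) G_(L-1) + e2 (q^L - q^(2L-1)) G_(L-2)
            + e3 (q^(3L-3) + e1 q^(2L-1)) G_(L-3) + e3^2 q^(3L-3) G_(L-4)
    up to the corrections 1 at L = 0 and e3 q^3 at L = 2, where sequences
    vanish at negative indices ([partition_sum_rec]). Those corrections are the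
    numerator 1 + ABC x^2 of the chains that start at 1.

    On the side of the triple sum, A, B and C are free, so the recurrence has
    to hold for the coefficient of each A^i B^j C^k separately ([summand_rec]).
    All summands involved are multiples of one of them by rational functions of
    q^i, q^j, q^k, q^L and q, and the recurrence becomes an identity between
    such functions as long as L-i, L-j and L-k are at least 2. Below this bound
    almost all summands vanish and the others are explicit. *)

(** * Sequences and convolutions *)

Section Sequences.
Variable R : comNzRingType.
Implicit Types (f g w : nat -> R) (a b : R).

(** Sequences stand for power series: [lag] is multiplication by x, [sub_lag a]
    is multiplication by 1 - a x, and [impulse] is the series 1. *)
Definition lag f n := if n is m.+1 then f m else 0.
Definition sub_lag a f n := f n - a * lag f n.
Definition impulse n : R := (n == 0%N)%:R.
Definition conv w g n := \sum_(l < n.+1) w l * g (n - l)%N.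

Lemma sub_lagC a b f : sub_lag a (sub_lag b f) = sub_lag b (sub_lag a f).
Proof. by apply: funext => -[|[|n]]; rewrite /sub_lag /=; ring. Qed.

Lemma conv_impulse g : conv impulse g = g.
Proof.
apply: funext => n; rewrite /conv big_ord_recl big1 => [|l _].
  by rewrite /impulse eqxx mul1r subn0 addr0.
by rewrite mul0r.
Qed.

Lemma conv_sub_lag a w g : conv (sub_lag a w) g = sub_lag a (conv w g).
Proof.
apply: funext => n; rewrite /conv /sub_lag.
under eq_bigr do rewrite mulrBl.
rewrite sumrB; congr (_ - _).
rewrite big_ord_recl /= mulr0 mul0r add0r.
case: n => [|n] /=; first by rewrite big_ord0 mulr0.
rewrite mulr_sumr; apply: eq_bigr => l _.
by rewrite /bump /= add1n subSS mulrA.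
Qed.

End Sequences.

(** * Generating functions of the chain weights *)

Section ChainWeights.
Variables (R : comNzRingType) (A B C : R).

(** The complete homogeneous symmetric polynomials in three and two variables. *)
Definition hsum3 n := sum_ijk A B C n%:Z.
Definition hsum2 n := sum_jk B C n%:Z.

Lemma sum_ijk_neg n : sum_ijk A B C (Negz n) = 0.
Proof. by rewrite /sum_ijk; do 2!(rewrite big1 => // ? _); rewrite big_pred0. Qed.

Lemma sum_jk_neg n : sum_jk B C (Negz n) = 0.
Proof. by rewrite /sum_jk; rewrite big1 => // ? _; rewrite big_pred0. Qed.

Lemma sub_lag_powers : sub_lag C (fun n => C ^+ n) = @impulse R.
Proof.
apply: funext => -[|n]; rewrite /sub_lag /impulse /=; first by rewrite mulr0 subr0.
by rewrite exprS subrr.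
Qed.

(** The monomials of degree n in B, C without a factor B reduce to C^n; dividing
    the others by B leaves all monomials of degree n - 1. *)
Lemma sub_lag_hsum2 : sub_lag B hsum2 = (fun n => C ^+ n).
Proof.
apply: funext => n; rewrite /sub_lag /hsum2 /sum_jk /= big_ord_recl /=.
have -> : \sum_(k < n.+1 | (0%N + k)%N%:Z == n%:Z) B ^+ 0 * C ^+ k = C ^+ n.
  by rewrite (big_pred1 ord_max) ?expr0 ?mul1r.
case: n => [|n]; first by rewrite big_ord0 /= mulr0; ring.
rewrite /= -[RHS]addr0 -addrA; congr (_ + _); apply/eqP; rewrite subr_eq0; apply/eqP.
rewrite mulr_sumr; apply: eq_bigr => j _.
rewrite big_mkcond big_ord_recr /= -big_mkcond /= mulr_sumr.
have -> : ((bump 0 j + n.+1)%N%:Z == n.+1%:Z) = false.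
  by rewrite /bump eqz_nat; lia.
rewrite addr0; apply: eq_big => [k|k _].
  by rewrite /bump /= !eqz_nat; lia.
by rewrite /bump /= exprS mulrA.
Qed.

(** As for [sub_lag_hsum2], splitting by divisibility by A. *)
Lemma sub_lag_hsum3 : sub_lag A hsum3 = hsum2.
Proof.
apply: funext => n; rewrite /sub_lag /hsum3 /sum_ijk /= big_ord_recl /=.
have -> : \sum_(j < n.+1) \sum_(k < n.+1 | (0 + j + k)%N%:Z == n%:Z)
   A ^+ 0 * B ^+ j * C ^+ k = hsum2 n.
  rewrite /hsum2 /sum_jk /=; apply: eq_bigr => j _; apply: eq_bigr => k _.
  by rewrite mul1r.
case: n => [|n]; first by rewrite big_ord0 /= mulr0; ring.
rewrite /= -[RHS]addr0 -addrA; congr (_ + _); apply/eqP; rewrite subr_eq0; apply/eqP.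
rewrite mulr_sumr; apply: eq_bigr => i _.
rewrite big_ord_recr /= [X in _ + X]big_pred0 ?addr0; last first.
  by move=> k; rewrite /bump eqz_nat; lia.
rewrite mulr_sumr; apply: eq_bigr => j _.
rewrite big_mkcond big_ord_recr /= -big_mkcond /= mulr_sumr.
have -> : ((bump 0 i + j + n.+1)%N%:Z == n.+1%:Z) = false.
  by rewrite /bump eqz_nat; lia.
rewrite addr0; apply: eq_big => [k|k _].
  by rewrite /bump /= !eqz_nat; lia.
by rewrite /bump /= exprS !mulrA.
Qed.

Definition denominator f := sub_lag A (sub_lag B (sub_lag C f)).
Definition numerator f :=
  sub_lag (- (A * B)) (sub_lag (- (A * C)) (sub_lag (- (B * C)) f)).

Lemma denominator_hsum3 : denominator hsum3 = @impulse R.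
Proof.
rewrite /denominator (sub_lagC B) (sub_lagC A C) (sub_lagC A B).
by rewrite sub_lag_hsum3 sub_lag_hsum2 sub_lag_powers.
Qed.

Definition bottom_weight n := chain_weight A B C 1 n.
(** The starting point 2 represents all starting points above 1. *)
Definition upper_weight n := chain_weight A B C 2 n.

Lemma sum_ijk_lag2 n : sum_ijk A B C (n%:Z - 2) = lag (lag hsum3) n.
Proof.
case: n => [|[|n]]; try exact: sum_ijk_neg.
by rewrite /= /hsum3; congr sum_ijk; lia.
Qed.

Lemma sum_jk_lag n : sum_jk B C (n%:Z - 1) = lag hsum2 n.
Proof.
case: n => [|n]; first exact: sum_jk_neg.
by rewrite /= /hsum2; congr sum_jk; lia.
Qed.

Lemma Fpoly_neg n : Fpoly A B C (Negz n) = 0.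
Proof.
rewrite /Fpoly (_ : Negz n - 2 = Negz n.+2) 1?(_ : Negz n - 1 = Negz n.+1); try lia.
by rewrite !sum_ijk_neg sum_jk_neg !mulr0 !addr0.
Qed.

(** The generating function of [Fpoly] is (1 + BCx) h(x): its last sum has the
    generating function BCx (1-Ax) h(x), whose second half cancels ABC x^2. *)
Lemma FpolyE : (fun n => Fpoly A B C n%:Z) = sub_lag (- (B * C)) hsum3.
Proof.
apply: funext => n; rewrite /Fpoly sum_ijk_lag2 sum_jk_lag -sub_lag_hsum3 -/(hsum3 n).
by case: n => [|[|n]]; rewrite /sub_lag /=; ring.
Qed.

Lemma bottom_weightE : bottom_weight = fun n => hsum3 n + A * B * C * lag (lag hsum3) n.
Proof. by apply: funext => n; rewrite /bottom_weight /chain_weight sum_ijk_lag2. Qed.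

(** The combination of three values of [Fpoly] multiplies its generating function
    by 1 + A(B+C)x + A^2 BC x^2 = (1+ABx)(1+ACx), which completes the symmetric
    product of the factors 1 + ABx, 1 + ACx and 1 + BCx. *)
Lemma upper_weightE : upper_weight = numerator hsum3.
Proof.
apply: funext => n; rewrite /upper_weight /chain_weight /= /numerator -FpolyE.
have -> : Fpoly A B C (n%:Z - 1) = lag (fun n => Fpoly A B C n%:Z) n.
  case: n => [|n]; first exact: Fpoly_neg.
  by rewrite /=; congr Fpoly; lia.
have -> : Fpoly A B C (n%:Z - 2) = lag (lag (fun n => Fpoly A B C n%:Z)) n.
  case: n => [|[|n]]; try exact: Fpoly_neg.
  by rewrite /=; congr Fpoly; lia.
by case: n => [|[|n]]; rewrite /sub_lag /=; ring.
Qed.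

Lemma denominator_bottom_weight n :
  denominator bottom_weight n
  = impulse R n + A * B * C * lag (lag (@impulse R)) n.
Proof.
rewrite -denominator_hsum3 bottom_weightE.
by case: n => [|[|[|[|[|n]]]]]; rewrite /denominator /sub_lag /=; ring.
Qed.

(** Since multiplication by linear factors moves in and out of a convolution,
    the denominator of h(x) cancels and only the numerator acts on [g]. *)
Lemma denominator_conv_upper_weight g :
  denominator (conv upper_weight g) = numerator g.
Proof.
rewrite /denominator -!conv_sub_lag -/(denominator _) upper_weightE /numerator.
have DN a f : denominator (sub_lag a f) = sub_lag a (denominator f).
  by rewrite /denominator (sub_lagC C) (sub_lagC B a) (sub_lagC A).
by rewrite !DN denominator_hsum3 !conv_sub_lag conv_impulse.
Qed.

End ChainWeights.

(** * Splitting off the chain of the largest part *)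

Lemma triS n : tri n.+1 = (tri n + n.+1)%N.
Proof. by rewrite /tri; have := mulnC n n.+1; lia. Qed.

Section Partitions.

Fixpoint partitions_le L : seq (seq nat) :=
  if L is L'.+1 then partitions_le L' ++ [seq L :: p | p <- partitions_le L']
  else [:: [::]].

Fixpoint top_run L l : seq nat := if l is l'.+1 then L :: top_run L.-1 l' else [::].

Lemma mem_partitions_le L p :
  (p \in partitions_le L) = distinct_partition p && all (geq L) p.
Proof.
rewrite /distinct_partition; elim: L p => [|L IH] p.
  rewrite inE; case: p => [|x p] //=.
  by case: x => [|x]; rewrite !(andbF, andFb).
rewrite mem_cat; case: p => [|x p]; first by rewrite IH.
apply/orP/idP.
  case=> [|/mapP[p' + [-> ->]]].
    rewrite IH => /andP[-> /allP le_L]; apply/allP => y /le_L /=; lia.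
  rewrite IH => /andP[/andP[sp p1] /allP le_L] /=.
  rewrite p1 leqnn /= !andbT; apply/andP; split.
    rewrite path_sortedE; last by move=> ? ? ? /=; lia.
    by rewrite sp andbT; apply/allP => y /le_L /=; lia.
  by apply/allP => y /le_L /=; lia.
move=> /andP[/andP[sp p1] le_L].
have [x_L|x_le] := eqVneq x L.+1; last first.
  left; rewrite IH sp p1 /=.
  move: sp le_L => /=; rewrite path_sortedE; last by move=> ? ? ? /=; lia.
  move=> /andP[/allP lt_x _] /andP[le_x _].
  by apply/andP; split; [lia|apply/allP => y /lt_x /=; lia].
right; rewrite x_L; apply: map_f; rewrite IH.
move: sp p1 => /=; rewrite path_sortedE; last by move=> ? ? ? /=; lia.
move=> /andP[/allP lt_x ->] /andP[_ ->] /=.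
by apply/allP => y /lt_x /=; lia.
Qed.

Lemma uniq_partitions_le L : uniq (partitions_le L).
Proof.
elim: L => [|L IH] //=; rewrite cat_uniq IH map_inj_uniq ?IH ?andbT; last first.
  by move=> p p' [].
apply/hasPn => _ /mapP[p _ ->]; rewrite mem_partitions_le /=.
by rewrite ltnn /= andbF.
Qed.

Lemma mem_top_run L l x : (l <= L)%N -> (x \in top_run L l) = (L - l < x <= L)%N.
Proof.
elim: l L => [|l IH] [|L] //= l_le; first by rewrite ?in_nil; lia.
  by rewrite in_nil; lia.
rewrite inE IH //; apply/idP/idP; lia.
Qed.

Lemma uniq_top_run L l : (l <= L)%N -> uniq (top_run L l).
Proof.
elim: l L => [|l IH] [|L] //= l_le.
by rewrite mem_top_run // ltnn andbF IH.
Qed.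

Lemma size_top_run L l : size (top_run L l) = l.
Proof. by elim: l L => //= l IH L; rewrite IH. Qed.

Lemma sumn_top_run L l : (l <= L)%N -> (sumn (top_run L l) + tri (L - l) = tri L)%N.
Proof.
elim: l L => [|l IH] [|L] //= l_le.
by rewrite subSS triS -(IH L l_le) /=; lia.
Qed.

Lemma chain_size p s l : is_chain p s l -> (l <= size p)%N.
Proof.
case/and4P=> _ /allP sub _ _; rewrite -(size_iota s l).
exact: uniq_leq_size (iota_uniq _ _) sub.
Qed.

Variables (R : comNzRingType) (A B C : R).

(** A partition with parts at most L either consists of the whole interval from
    1 to L, or it contains exactly the l largest elements of this interval above
    its first gap L - l; the parts below the gap are then at most L - l - 1. *)
Lemma big_partitions_le L (f : seq nat -> R) :
  \sum_(p <- partitions_le L) f p =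
  \sum_(l < L) \sum_(p <- partitions_le (L - l.+1)) f (top_run L l ++ p)
  + f (top_run L L).
Proof.
elim: L f => [|L IH] f; first by rewrite big_seq1 big_ord0 add0r.
rewrite /= big_cat big_map /= (IH (fun p => f (L.+1 :: p))) big_ord_recl /=.
by rewrite subSS subn0 addrA.
Qed.

(** A chain is no longer than the partition, so that the range of lengths in
    [weight] can be that of a larger partition. *)
Lemma big_chain_widen p s N (F : nat -> R) : (size p <= N)%N ->
  \prod_(1 <= l < N.+1 | is_chain p s l) F l =
  \prod_(1 <= l < (size p).+1 | is_chain p s l) F l.
Proof.
move=> le_N; rewrite (@big_cat_nat _ _ _ (size p).+1) //=.
rewrite [X in _ * X]big_nat_cond [X in _ * X]big_pred0 ?mulr1 // => l.
by apply/negP => /andP[lt_l /chain_size]; lia.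
Qed.

(** The gap at L - l separates the top run from [p]: no chain passes through it,
    so the chains of [p] stay chains, and the run contributes one chain, which
    starts right above the gap. *)
Lemma weight_top_run L l p : (0 < l <= L)%N -> all (fun x => x < L - l)%N p ->
  weight A B C (top_run L l ++ p) =
  chain_weight A B C (L - l).+1 l * weight A B C p.
Proof.
move=> l_bd /allP p_lt; have le_L : (l <= L)%N by lia.
have memE x : (x \in top_run L l ++ p) =
    ((L - l < x <= L) || (x \in p))%N by rewrite mem_cat mem_top_run.
have gapP : (L - l)%N \notin top_run L l ++ p.
  by rewrite memE; apply/negP => /orP[|/p_lt]; lia.
rewrite /weight big_cat /=; congr (_ * _); last first.
  apply: eq_big_seq => s s_p; rewrite -(@big_chain_widen p s (size (top_run L l ++ p))).
    apply: eq_bigl => l'; rewrite /is_chain; case: ltnP => //= l'_gt.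
    have s_lt := p_lt s s_p.
    have memlow x : (x <= L - l)%N -> (x \in top_run L l ++ p) = (x \in p).
      by move=> x_le; rewrite memE; case: (x \in p) => //; lia.
    rewrite memlow; last by lia.
    (* A candidate that starts below the gap either stays below it, where the
       two partitions agree, or would have to contain it. *)
    have [le_b|gt_b] := leqP (s + l') (L - l).
      rewrite memlow //; congr (_ && _); apply: eq_in_all => x.
      by rewrite mem_iota => x_bd /=; rewrite memlow //; lia.
    have gap_in : (L - l)%N \in iota s l' by rewrite mem_iota; lia.
    have -> : all (mem (top_run L l ++ p)) (iota s l') = false.
      by apply/negP => /allP /(_ _ gap_in) /=; rewrite (negbTE gapP).
    have -> // : all (mem p) (iota s l') = false.
    apply/negP => /allP /(_ _ gap_in) /= /p_lt; lia.
  by rewrite size_cat leq_addl.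
rewrite (bigD1_seq (L - l).+1) /=; last 2 first.
- by rewrite mem_top_run //; lia.
- exact: uniq_top_run.
(* Every other part of the run has its predecessor in the run. *)
rewrite [X in _ * X]big_seq_cond [X in _ * X]big1 ?mulr1; last first.
  move=> s; rewrite mem_top_run // => s_bd; rewrite big_pred0 // => l'.
  have -> : is_chain (top_run L l ++ p) s l' = false; last by [].
  rewrite /is_chain (_ : s.-1 \in _) ?andbF //.
  by rewrite memE; apply/orP; left; lia.
rewrite -big_filter (_ : [seq _ <- _ | _] = [:: l]) ?big_seq1 //.
have chainE l' : (0 < l')%N -> is_chain (top_run L l ++ p) (L - l).+1 l' = (l' == l).
  move=> l'_gt; rewrite /is_chain l'_gt gapP /=.
  have [->|ne] := eqVneq l' l.
    apply/andP; split.
      by apply/allP => x; rewrite mem_iota /= memE => x_bd; apply/orP; left; lia.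
    by rewrite memE; apply/negP => /orP[|/p_lt]; lia.
  have [lt|gt] := ltnP l' l.
    by rewrite memE andbC (_ : (_ < _ <= _)%N) //; lia.
  apply/negP => /andP[/allP /(_ L.+1)]; rewrite mem_iota /= memE => H _.
  have /orP[|/p_lt] : (L - l < L.+1 <= L)%N || (L.+1 \in p) by apply: H; lia.
    by lia.
  by lia.
rewrite -[RHS](@filter_pred1_uniq _ (index_iota 1 (size (top_run L l ++ p)).+1) l).
- apply: eq_in_filter => l'; rewrite mem_index_iota => /andP[l'_gt _].
  exact: chainE.
- by rewrite /index_iota iota_uniq.
- by rewrite mem_index_iota size_cat size_top_run; lia.
Qed.

Lemma upper_weight_chain s l : (1 < s)%N ->
  chain_weight A B C s l = upper_weight A B C l.
Proof. by case: s => [|[]]. Qed.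

Lemma hsum3_0 : hsum3 A B C 0 = 1.
Proof.
by have := congr1 (fun f => f 0%N) (denominator_hsum3 A B C);
   rewrite /denominator /sub_lag /impulse /= !mulr0 !subr0.
Qed.

Lemma upper_weight0 : upper_weight A B C 0 = 1.
Proof. by rewrite upper_weightE /numerator /sub_lag /= hsum3_0 !mulr0 !subr0. Qed.

Lemma bottom_weight0 : bottom_weight A B C 0 = 1.
Proof. by rewrite bottom_weightE /= hsum3_0 mulr0 addr0. Qed.

Lemma weight_nil : weight A B C [::] = 1.
Proof. by rewrite /weight big_nil. Qed.

Variable q : R.

Definition partition_sum L := \sum_(p <- partitions_le L) weight A B C p * q ^+ sumn p.

(** The term l = 0 stands for the partitions without the part [L]; it fits the
    pattern because the weight of an empty chain is 1. The last term belongs to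
    the partition into all parts from 1 to L. *)
Lemma partition_sum_conv L : partition_sum L =
  \sum_(l < L) upper_weight A B C l * q ^+ (tri L - tri (L - l))
    * partition_sum (L - l.+1)
  + bottom_weight A B C L * q ^+ tri L.
Proof.
rewrite /partition_sum big_partitions_le; congr (_ + _).
  apply: eq_bigr => l _; rewrite mulr_sumr; apply: eq_big_seq => p.
  rewrite mem_partitions_le => /andP[_ /allP p_le].
  have l_lt := ltn_ord l.
  have -> : (tri L - tri (L - l) = sumn (top_run L l))%N.
    by rewrite -(sumn_top_run (ltnW l_lt)) addnK.
  have -> : weight A B C (top_run L l ++ p) = upper_weight A B C l * weight A B C p.
    have [l0|l_gt] := posnP l.
      by rewrite l0 /= upper_weight0 mul1r.
    rewrite weight_top_run; first by congr (_ * _); apply: upper_weight_chain; lia.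
      by lia.
    by apply/allP => x /p_le /=; lia.
  by rewrite sumn_cat exprD; ring.
have [->|L_gt] := posnP L; first by rewrite /= weight_nil bottom_weight0.
rewrite -[top_run L L]cats0 weight_top_run //= ?L_gt ?leqnn // weight_nil mulr1 cats0.
by rewrite subnn /bottom_weight -(sumn_top_run (leqnn L)) subnn addn0.
Qed.

End Partitions.

(** * The recurrence for the sum over partitions *)

Section Recurrence.
Variables (K : fieldType) (A B C q : K).

(** The truncated exponents are harmless, as they accompany lagged values that
    vanish when the subtraction truncates. *)
Definition four_term_rec (G : nat -> K) := forall n,
  G n = (1 + (A + B + C) * q ^+ n) * lag G n
    + (A * B + A * C + B * C) * (q ^+ n - q ^+ (2 * n - 1)) * lag (lag G) n
    + A * B * C * (q ^+ (3 * n - 3) + (A + B + C) * q ^+ (2 * n - 1))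
      * lag (lag (lag G)) n
    + (A * B * C) ^+ 2 * q ^+ (3 * n - 3) * lag (lag (lag (lag G))) n
    + impulse K n + A * B * C * q ^+ 3 * lag (lag (@impulse K)) n.

Lemma four_term_rec_unique G H : four_term_rec G -> four_term_rec H -> G =1 H.
Proof.
move=> recG recH; elim/ltn_ind => n IH; rewrite (recG n) (recH n).
by case: n IH => [|[|[|[|n]]]] IH /=; rewrite ?IH //; lia.
Qed.

Hypothesis q_neq0 : q != 0.

(** Division by q^(T_L) turns the splitting into a genuine convolution with
    the generating function of the upper weights; multiplying it by the
    denominator of h(x) gives the recurrence. *)
Lemma partition_sum_rec : four_term_rec (partition_sum A B C q).
Proof.
set G := partition_sum A B C q.
pose c n := G n / q ^+ tri n; pose g n := lag G n / q ^+ tri n.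
have cE n : c n = conv (upper_weight A B C) g n + bottom_weight A B C n.
  rewrite /c /G partition_sum_conv mulrDl mulfK ?expf_neq0 //; congr (_ + _).
  rewrite /conv big_ord_recr /= subnn /g mul0r mulr0 addr0 mulr_suml.
  apply: eq_bigr => l _; have l_lt := ltn_ord l.
  rewrite -(sumn_top_run (ltnW l_lt)) addnK exprD.
  case E: (n - l)%N => [|m]; first by lia.
  have -> : (n - l.+1)%N = m by lia.
  rewrite /= /G; field; by rewrite !expf_neq0.
have D n : denominator A B C c n = numerator A B C g n + impulse K n
    + A * B * C * lag (lag (@impulse K)) n.
  rewrite -denominator_conv_upper_weight -addrA -denominator_bottom_weight.
  by case: n => [|[|[|n]]]; rewrite /denominator /sub_lag /= !cE; ring.
have qT k : q ^+ tri k != 0 by rewrite expf_neq0.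
(* The recurrence is the coefficient of x^n of D, multiplied by q^(T_n). *)
have scale a b x y t : a = b -> x - y = t * (a - b) -> x = y :> K.
  by move=> ->; rewrite subrr mulr0 => /eqP; rewrite subr_eq0 => /eqP.
have tri0 : tri 0 = 0%N by [].
move=> n; apply: (scale _ _ _ _ (q ^+ tri n) (D n)).
case: n => [|[|[|[|n]]]];
  rewrite /denominator /numerator /sub_lag /impulse /g /c /=.
- by rewrite tri0; field; rewrite oner_neq0.
- have -> : tri 1 = 1%N by [].
  by rewrite tri0; field; rewrite ?oner_neq0 ?q_neq0.
- have -> : tri 1 = 1%N by [].
  have -> : tri 2 = 3%N by [].
  by rewrite tri0; field; rewrite ?oner_neq0 ?q_neq0.
- have -> : tri 1 = 1%N by [].
  have -> : tri 2 = 3%N by [].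
  have -> : tri 3 = 6%N by [].
  by rewrite tri0; field; rewrite ?oner_neq0 ?q_neq0.
have -> : (2 * n.+4 - 1 = n * 2 + 7)%N by lia.
have -> : (3 * n.+4 - 3 = n * 3 + 9)%N by lia.
rewrite !triS !exprD !exprM !exprS.
field; rewrite q_neq0 qT expf_neq0 //.
Qed.

End Recurrence.

(** * The recurrence for the coefficients of the triple sum *)

Section TripleProduct.
Variables (K : fieldType) (q : K).

(** The q-binomial coefficient is a product of [poch] and two values of [ipoch],
    the reciprocal of the q-factorial. Letting [ipoch] vanish at negative indices
    makes its contiguity relation, and that of [tri_ipoch], valid for all
    integers. *)
Definition poch (n : int) : K := qpoch q q `|n|.
Definition ipoch (n : int) : K := if n is Posz m then (qpoch q q m)^-1 else 0.
Definition tri_ipoch (n : int) : K := q ^+ tri `|n| * ipoch n.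

Lemma qpochS n : qpoch q q n.+1 = qpoch q q n * (1 - q ^+ n.+1).
Proof. by rewrite /qpoch big_ord_recr /= -exprS. Qed.

Lemma qpoch0 : qpoch q q 0 = 1.
Proof. by rewrite /qpoch big_ord0. Qed.

Lemma qbinomE M n : qbinom q M n = poch M * ipoch n * ipoch (M - n).
Proof.
rewrite /qbinom; case: n => n; last by rewrite /= mulr0 mul0r.
case E: (M - n%:Z) => [m|m] /=; last by rewrite mulr0.
have -> : M = (n + m)%N by lia.
by rewrite /poch /= invfM mulrA.
Qed.

Lemma ipoch_neg n : n < 0 -> ipoch n = 0.
Proof. by case: n. Qed.

Lemma tri_ipoch_neg n : n < 0 -> tri_ipoch n = 0.
Proof. by move=> n_lt; rewrite /tri_ipoch ipoch_neg ?mulr0. Qed.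

(** The coefficient of A^i B^j C^k in the triple sum. *)
Definition summand (L i j k : int) : K :=
  q ^+ (tri `|i| + tri `|j| + tri `|k|)
  * qbinom q (L - i) j * qbinom q (L - j) k * qbinom q (L - k) i.

(** Up to the factors [poch], the summand is a function of i, j, k and of the
    three differences a, b, c. The names for the differences allow stating the
    shifted summands in terms of the same six numbers. *)
Lemma summandE L i j k X Y Z a b c :
  X = L - i -> Y = L - j -> Z = L - k ->
  a = L - j - k -> b = L - i - k -> c = L - i - j ->
  summand L i j k = tri_ipoch i * tri_ipoch j * tri_ipoch k
    * (ipoch a * ipoch b * ipoch c)
    * (poch X * poch Y * poch Z).
Proof.
move=> -> -> -> -> -> ->; rewrite /summand !qbinomE /tri_ipoch !exprD.
by rewrite (addrAC L (- k)); ring.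
Qed.

Lemma summand_eq0 L i j k :
  [|| i < 0, j < 0, k < 0, L < i + j, L < j + k | L < i + k] -> summand L i j k = 0.
Proof.
move=> H; rewrite (@summandE L i j k _ _ _ _ _ _ erefl erefl erefl erefl erefl erefl).
case/or4P: H => [H|H|H|H]; first by rewrite (tri_ipoch_neg H) !mul0r.
- by rewrite (tri_ipoch_neg H) !(mulr0, mul0r).
- by rewrite (tri_ipoch_neg H) !(mulr0, mul0r).
by case/or3P: H => H; [rewrite (ipoch_neg (n := L - i - j))
  |rewrite (ipoch_neg (n := L - j - k))|rewrite (ipoch_neg (n := L - i - k))];
  rewrite ?(mulr0, mul0r) //; lia.
Qed.

Lemma summand_big M i j k : [|| M < i, M < j | M < k] -> summand M i j k = 0.
Proof.
move=> H; case: (boolP [|| i < 0, j < 0 | k < 0]) => [neg|nneg]; apply: summand_eq0; lia.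
Qed.

Lemma summand_swap L i j k : summand L i j k = summand L i k j.
Proof.
rewrite (@summandE L i j k _ _ _ _ _ _ erefl erefl erefl erefl erefl erefl).
rewrite (@summandE L i k j _ _ _ _ _ _ erefl erefl erefl erefl erefl erefl).
by rewrite (addrAC L (- k)); ring.
Qed.

Lemma summand_rot L i j k : summand L i j k = summand L j k i.
Proof. by rewrite /summand -(addnA (tri `|i|)) (addnC (tri `|i|)); ring. Qed.

(** The coefficient of A^i B^j C^k on the right of the recurrence, without the
    corrections: each factor A, B or C there lowers an index by one. *)
Definition summand_rhs (L i j k : int) : K :=
  summand (L - 1) i j k
  + q ^ L * (summand (L - 1) (i - 1) j k + summand (L - 1) i (j - 1) k
             + summand (L - 1) i j (k - 1))
  + (q ^ L - q ^ (L * 2 - 1))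
    * (summand (L - 2) (i - 1) (j - 1) k + summand (L - 2) (i - 1) j (k - 1)
       + summand (L - 2) i (j - 1) (k - 1))
  + q ^ (L * 3 - 3) * summand (L - 3) (i - 1) (j - 1) (k - 1)
  + q ^ (L * 2 - 1)
    * (summand (L - 3) (i - 1 - 1) (j - 1) (k - 1)
       + summand (L - 3) (i - 1) (j - 1 - 1) (k - 1)
       + summand (L - 3) (i - 1) (j - 1) (k - 1 - 1))
  + q ^ (L * 3 - 3) * summand (L - 4) (i - 1 - 1) (j - 1 - 1) (k - 1 - 1).

Lemma summand_rhs_rot L i j k : summand_rhs L i j k = summand_rhs L j k i.
Proof.
have R := summand_rot.
rewrite /summand_rhs (R _ i j k) (R _ (i - 1) j k) (R _ i (j - 1) k).
rewrite (R _ i j (k - 1)) (R _ (i - 1) (j - 1) k) (R _ (i - 1) j (k - 1)).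
rewrite (R _ i (j - 1) (k - 1)) (R _ (i - 1) (j - 1) (k - 1)).
rewrite (R _ (i - 1 - 1) (j - 1) (k - 1)) (R _ (i - 1) (j - 1 - 1) (k - 1)).
rewrite (R _ (i - 1) (j - 1) (k - 1 - 1)).
by rewrite (R _ (i - 1 - 1) (j - 1 - 1) (k - 1 - 1)); ring.
Qed.

Hypotheses (q_neq0 : q != 0) (q_pow_neq1 : forall n, q ^+ n.+1 != 1).

Lemma qpow_sub_neq0 n : 1 - q ^+ n.+1 != 0.
Proof. by rewrite subr_eq0 eq_sym. Qed.

Lemma qpoch_neq0 n : qpoch q q n != 0.
Proof.
elim: n => [|n IH]; first by rewrite qpoch0 oner_neq0.
by rewrite qpochS mulf_neq0 // qpow_sub_neq0.
Qed.

Lemma ipoch_pred n : ipoch (n - 1) = (1 - q ^ n) * ipoch n.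
Proof.
case: n => [[|n]|n]; last by rewrite mulr0 ipoch_neg //; lia.
  by rewrite expr0z subrr mul0r.
have -> : n.+1%:Z - 1 = n by lia.
rewrite /= qpochS -?exprnP; field.
by rewrite qpoch_neq0 qpow_sub_neq0.
Qed.

Lemma tri_ipoch_pred n : tri_ipoch (n - 1) = ((q ^ n)^-1 - 1) * tri_ipoch n.
Proof.
rewrite /tri_ipoch ipoch_pred; case: n => [[|n]|n]; last by rewrite !mulr0.
  by rewrite expr0z invr1 subrr !mul0r mulr0.
have -> : n.+1%:Z - 1 = n by lia.
rewrite /= triS exprD -?exprnP; field.
by rewrite qpoch_neq0 expf_neq0.
Qed.

Lemma poch_pred n : 1 <= n -> poch n = (1 - q ^ n) * poch (n - 1).
Proof.
case: n => [[|n]|n] // _; have -> : n.+1%:Z - 1 = n by lia.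
by rewrite /poch /= qpochS -?exprnP mulrC.
Qed.

(** The contiguity relations of [ipoch] and [tri_ipoch] hold for all integers,
    that of [poch] for positive ones; as the recurrence lowers the indices of
    [poch] by at most 2, the bounds let all summands be reduced to multiples of
    one product, with factors that are rational in q and its powers with
    exponents i, j, k and L. *)
Lemma summand_rec_generic L i j k :
  2 <= L - i -> 2 <= L - j -> 2 <= L - k -> summand L i j k = summand_rhs L i j k.
Proof.
move=> X2 Y2 Z2.
pose X := L - i; pose Y := L - j; pose Z := L - k.
pose a := L - j - k; pose b := L - i - k; pose c := L - i - j.
rewrite /summand_rhs (@summandE L i j k X Y Z a b c) //.
rewrite (@summandE (L - 1) i j k (X - 1) (Y - 1) (Z - 1) (a - 1) (b - 1) (c - 1));
  try (rewrite /X /Y /Z /a /b /c; lia).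
rewrite (@summandE (L - 1) (i - 1) j k X (Y - 1) (Z - 1) (a - 1) b c);
  try (rewrite /X /Y /Z /a /b /c; lia).
rewrite (@summandE (L - 1) i (j - 1) k (X - 1) Y (Z - 1) a (b - 1) c);
  try (rewrite /X /Y /Z /a /b /c; lia).
rewrite (@summandE (L - 1) i j (k - 1) (X - 1) (Y - 1) Z a b (c - 1));
  try (rewrite /X /Y /Z /a /b /c; lia).
rewrite (@summandE (L - 2) (i - 1) (j - 1) k (X - 1) (Y - 1) (Z - 1 - 1)
  (a - 1) (b - 1) c);
  try (rewrite /X /Y /Z /a /b /c; lia).
rewrite (@summandE (L - 2) (i - 1) j (k - 1) (X - 1) (Y - 1 - 1) (Z - 1)
  (a - 1) b (c - 1));
  try (rewrite /X /Y /Z /a /b /c; lia).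
rewrite (@summandE (L - 2) i (j - 1) (k - 1) (X - 1 - 1) (Y - 1) (Z - 1)
  a (b - 1) (c - 1));
  try (rewrite /X /Y /Z /a /b /c; lia).
rewrite (@summandE (L - 3) (i - 1) (j - 1) (k - 1) (X - 1 - 1) (Y - 1 - 1)
  (Z - 1 - 1) (a - 1) (b - 1) (c - 1));
  try (rewrite /X /Y /Z /a /b /c; lia).
rewrite (@summandE (L - 3) (i - 1 - 1) (j - 1) (k - 1) (X - 1) (Y - 1 - 1)
  (Z - 1 - 1) (a - 1) b c);
  try (rewrite /X /Y /Z /a /b /c; lia).
rewrite (@summandE (L - 3) (i - 1) (j - 1 - 1) (k - 1) (X - 1 - 1) (Y - 1)
  (Z - 1 - 1) a (b - 1) c);
  try (rewrite /X /Y /Z /a /b /c; lia).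
rewrite (@summandE (L - 3) (i - 1) (j - 1) (k - 1 - 1) (X - 1 - 1) (Y - 1 - 1)
  (Z - 1) a b (c - 1));
  try (rewrite /X /Y /Z /a /b /c; lia).
rewrite (@summandE (L - 4) (i - 1 - 1) (j - 1 - 1) (k - 1 - 1) (X - 1 - 1)
  (Y - 1 - 1) (Z - 1 - 1) a b c);
  try (rewrite /X /Y /Z /a /b /c; lia).
rewrite (poch_pred (n := X)) ?(poch_pred (n := X - 1)); try (rewrite /X; lia).
rewrite (poch_pred (n := Y)) ?(poch_pred (n := Y - 1)); try (rewrite /Y; lia).
rewrite (poch_pred (n := Z)) ?(poch_pred (n := Z - 1)); try (rewrite /Z; lia).
rewrite !tri_ipoch_pred !ipoch_pred.
have u0 := expfz_neq0 L q_neq0; have x0 := expfz_neq0 i q_neq0.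
have y0 := expfz_neq0 j q_neq0; have z0 := expfz_neq0 k q_neq0.
rewrite /X /Y /Z /a /b /c !(expfzDr, =^~ invr_expz, =^~ exprz_exp) //.
rewrite -!exprnP.
move: (q ^ i) (q ^ j) (q ^ k) (q ^ L) x0 y0 z0 u0 => x y z u x0 y0 z0 u0.
by field; rewrite q_neq0 x0 y0 z0.
Qed.

Lemma ipoch_poch (n : nat) : ipoch n * poch n = 1.
Proof. by rewrite /ipoch /poch mulVf ?qpoch_neq0. Qed.

Lemma poch0 : poch 0 = 1. Proof. exact: qpoch0. Qed.
Lemma poch1 : poch 1 = 1 - q.
Proof. by rewrite /poch /= qpochS qpoch0 mul1r expr1. Qed.

Lemma ipoch0 : ipoch 0 = 1. Proof. by rewrite /= qpoch0 invr1. Qed.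
Lemma ipoch1 : ipoch 1 = (1 - q)^-1.
Proof. by rewrite /= -[qpoch _ _ _]/(poch 1) poch1. Qed.
Lemma tri_ipoch0 : tri_ipoch 0 = 1. Proof. by rewrite /tri_ipoch ipoch0 mulr1. Qed.
Lemma tri_ipoch1 : tri_ipoch 1 = q / (1 - q).
Proof. by rewrite /tri_ipoch ipoch1 expr1. Qed.
Lemma tri_ipochE (n : nat) : tri_ipoch n = q ^+ tri n * ipoch n. Proof. by []. Qed.
Lemma pochS (n : nat) : poch n.+1 = (1 - q ^+ n.+1) * poch n.
Proof. by rewrite /poch /= qpochS mulrC. Qed.

Lemma one_sub_q_neq0 : 1 - q != 0.
Proof. by have := qpow_sub_neq0 0; rewrite expr1. Qed.

Lemma summand_n00 (n : nat) : summand n n 0 0 = q ^+ tri n.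
Proof.
rewrite (@summandE _ _ _ _ 0 n n n 0 0) ?tri_ipoch0 ?ipoch0 ?poch0 ?tri_ipochE; try lia.
by transitivity (q ^+ tri n * (ipoch n * poch n) ^+ 2); [ring|rewrite ipoch_poch; ring].
Qed.

Lemma summand_n1_00 (n : nat) :
  summand n.+1 n 0 0 = q ^+ tri n * ((1 - q ^+ n.+1) / (1 - q)).
Proof.
rewrite (@summandE _ _ _ _ 1 n.+1 n.+1 n.+1 1 1); try lia.
rewrite tri_ipoch0 ipoch1 poch1 tri_ipochE.
transitivity (q ^+ tri n * (ipoch n * (ipoch n.+1 * poch n.+1) * poch n.+1) / (1 - q)).
  by field; rewrite one_sub_q_neq0.
by rewrite ipoch_poch mulr1 pochS [ipoch n * _]mulrCA ipoch_poch; ring.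
Qed.

Lemma summand_n1_10 (n : nat) :
  summand n.+1 n 1 0 = q ^+ (tri n).+1 * ((1 - q ^+ n.+1) / (1 - q)).
Proof.
rewrite (@summandE _ _ _ _ 1 n n.+1 n 1 0); try lia.
rewrite tri_ipoch0 tri_ipoch1 ipoch1 ipoch0 poch1 tri_ipochE exprS.
transitivity (q ^+ tri n * q * ((ipoch n * poch n) * (ipoch n * poch n.+1)) / (1 - q)).
  by field; rewrite one_sub_q_neq0.
by rewrite ipoch_poch mul1r pochS [ipoch n * _]mulrCA ipoch_poch; ring.
Qed.

Lemma summand_n1_01 (n : nat) :
  summand n.+1 n 0 1 = q ^+ (tri n).+1 * ((1 - q ^+ n.+1) / (1 - q)).
Proof. by rewrite summand_swap summand_n1_10. Qed.

Lemma summand_n1_11 (n : nat) :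
  summand n.+1 n 1 1 = q ^+ (tri n).+2 * ((1 - q ^+ n) / (1 - q)).
Proof.
case: n => [|n]; first by rewrite summand_eq0 // subrr mul0r mulr0.
rewrite (@summandE _ _ _ _ 1 n.+1 n.+1 n 0 0); try lia.
rewrite tri_ipoch1 ipoch0 poch1 tri_ipochE !exprS.
transitivity (q * q * q ^+ tri n.+1 *
    (ipoch n.+1 * poch n.+1 * (ipoch n * poch n.+1)) / (1 - q)).
  by field; rewrite one_sub_q_neq0.
by rewrite ipoch_poch mul1r pochS [ipoch n * _]mulrCA ipoch_poch exprS; ring.
Qed.

Ltac drop_zero_terms := repeat
  match goal with |- context [summand ?L ?i ?j ?k] =>
    rewrite (@summand_eq0 L i j k); [|lia] end.

(** When L - i is 0 or 1, a summand can be nonzero only if j and k are at most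
    L - i, which leaves five cases with explicit values. The corrections of the
    recurrence appear here. *)
Lemma summand_low i j k (L : nat) : L%:Z - i <= 1 ->
  summand L i j k = summand_rhs L i j k
    + [&& L == 0%N, i == 0, j == 0 & k == 0]%:R
    + q ^+ 3 * [&& L == 2%N, i == 1, j == 1 & k == 1]%:R.
Proof.
move=> i_ge; rewrite /summand_rhs.
have [i_gt|i_le] := ltrP L%:Z i.
  have -> : [&& L == 0%N, i == 0, j == 0 & k == 0] = false by lia.
  have -> : [&& L == 2%N, i == 1, j == 1 & k == 1] = false by lia.
  by drop_zero_terms; rewrite !(mulr0, addr0).
have [i_eq|i_ne] := eqVneq i L%:Z.
  have -> : [&& L == 2%N, i == 1, j == 1 & k == 1] = false by lia.
  have [/andP[/eqP-> /eqP->]|jk_neq0] := boolP ((j == 0) && (k == 0)); last first.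
    by rewrite !andbF; drop_zero_terms; rewrite !(mulr0, addr0).
  rewrite i_eq; case: L {i_ge i_le i_eq} => [|n].
    by rewrite summand_n00; drop_zero_terms; rewrite !(mulr0, addr0, add0r).
  have -> : n.+1%:Z - 1 = n by lia.
  drop_zero_terms; rewrite !summand_n00 triS exprD -exprnP /=.
  by rewrite !(mulr0, addr0, add0r) mulrC.
have i_eq : i + 1 = L%:Z by lia.
have -> : [&& L == 0%N, i == 0, j == 0 & k == 0] = false by lia.
case: i i_ge i_le i_ne i_eq => [n|n] _ _ _ i_eq; last first.
  by rewrite !andbF; drop_zero_terms; rewrite !(mulr0, addr0).
have -> : L = n.+1 by lia.
have predS (m : nat) : m.+1%:Z - 1 = m by lia.
have [/andP[/eqP-> /eqP->]|jk00] := boolP ((j == 0) && (k == 0)).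
  rewrite !andbF; case: n {i_eq} => [|n].
    rewrite predS; drop_zero_terms; rewrite summand_n1_00 summand_n00 -?exprnP.
    rewrite !(mulr0, addr0, add0r) !expr1.
    by field; rewrite one_sub_q_neq0.
  rewrite !predS; drop_zero_terms; rewrite !summand_n1_00 summand_n00 triS -exprnP exprD.
  rewrite !(mulr0, addr0, add0r) (exprS _ n.+1).
  by field; rewrite one_sub_q_neq0.
have [/andP[/eqP-> /eqP->]|jk10] := boolP ((j == 1) && (k == 0)).
  rewrite !andbF subrr; case: n {i_eq} => [|n].
    rewrite predS; drop_zero_terms; rewrite summand_n1_10 summand_n00 -exprnP !expr1.
    rewrite !(mulr0, addr0, add0r).
    by field; rewrite one_sub_q_neq0.
  have -> : n.+2%:Z - 2 = n by lia.
  have -> : n.+2%:Z * 2 - 1 = (n * 2 + 3)%N by lia.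
  rewrite !predS; drop_zero_terms; rewrite !summand_n1_10 !summand_n00.
  rewrite !(mulr0, addr0, add0r) triS -!exprnP !(exprD, exprS) exprM.
  by field; rewrite one_sub_q_neq0.
have [/andP[/eqP-> /eqP->]|jk01] := boolP ((j == 0) && (k == 1)).
  rewrite !andbF subrr; case: n {i_eq} => [|n].
    rewrite predS; drop_zero_terms; rewrite summand_n1_01 summand_n00 -exprnP !expr1.
    rewrite !(mulr0, addr0, add0r).
    by field; rewrite one_sub_q_neq0.
  have -> : n.+2%:Z - 2 = n by lia.
  have -> : n.+2%:Z * 2 - 1 = (n * 2 + 3)%N by lia.
  rewrite !predS; drop_zero_terms; rewrite !summand_n1_01 !summand_n00.
  rewrite !(mulr0, addr0, add0r) triS -!exprnP !(exprD, exprS) exprM.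
  by field; rewrite one_sub_q_neq0.
have [/andP[/eqP-> /eqP->]|jk11] := boolP ((j == 1) && (k == 1)); last first.
  by rewrite ?andbF; drop_zero_terms; rewrite !(mulr0, addr0).
rewrite subrr; case: n {i_eq} => [|[|n]].
- by rewrite predS; drop_zero_terms; rewrite !(mulr0, addr0).
- rewrite !predS; drop_zero_terms; rewrite summand_n1_11 !(mulr0, addr0, add0r) expr1.
  by rewrite divff ?one_sub_q_neq0.
have -> : n.+3%:Z - 3 = n by lia.
have -> : n.+3%:Z * 2 - 1 = (n * 2 + 5)%N by lia.
rewrite !predS; drop_zero_terms; rewrite !summand_n1_11 !summand_n00.
rewrite !(mulr0, addr0, add0r) !triS -!exprnP !(exprD, exprS) exprM.
by field; rewrite one_sub_q_neq0.
Qed.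

(** The recurrence is invariant under cyclic rotations of (i, j, k), so that the
    case of a small difference reduces to that of a small L - i. *)
Lemma summand_rec i j k (L : nat) :
  summand L i j k = summand_rhs L i j k
    + [&& L == 0%N, i == 0, j == 0 & k == 0]%:R
    + q ^+ 3 * [&& L == 2%N, i == 1, j == 1 & k == 1]%:R.
Proof.
have [i_le|i_gt] := lerP (L%:Z - i) 1; first exact: summand_low.
have [j_le|j_gt] := lerP (L%:Z - j) 1.
  rewrite summand_rot summand_rhs_rot summand_low //.
  congr (_ + (nat_of_bool _)%:R + _ * (nat_of_bool _)%:R).
    by rewrite [RHS]andbA; case: (L == _) (i == _) (j == _) (k == _) => [] [] [] [].
  by case: (L == _) (i == _) (j == _) (k == _) => [] [] [] [].
have [k_le|k_gt] := lerP (L%:Z - k) 1.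
  rewrite -summand_rot -summand_rhs_rot summand_low //.
  congr (_ + (nat_of_bool _)%:R + _ * (nat_of_bool _)%:R).
    by case: (L == _) (i == _) (j == _) (k == _) => [] [] [] [].
  by case: (L == _) (i == _) (j == _) (k == _) => [] [] [] [].
rewrite summand_rec_generic; try lia.
have -> : [&& L == 0%N, i == 0, j == 0 & k == 0] = false by lia.
have -> : [&& L == 2%N, i == 1, j == 1 & k == 1] = false by lia.
by rewrite mulr0 !addr0.
Qed.

End TripleProduct.

(** * The recurrence for the triple sum *)

Section TripleSum.
Variables (K : fieldType) (A B C q : K).

(** Coefficient functions live on the integers, so that lowering an index never
    truncates. *)
Definition psum (x : K) N (g : int -> K) := \sum_(i < N) g i%:Z * x ^+ i.

Lemma eq_psum x N g h : (forall i, g i = h i) -> psum x N g = psum x N h.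
Proof. by move=> gh; apply: eq_bigr => i _; rewrite gh. Qed.

Lemma psumD x N g h : psum x N (fun i => g i + h i) = psum x N g + psum x N h.
Proof. by rewrite -big_split; apply: eq_bigr => i _; rewrite mulrDl. Qed.

Lemma psumZ x N c g : psum x N (fun i => c * g i) = c * psum x N g.
Proof. by rewrite mulr_sumr; apply: eq_bigr => i _; rewrite mulrA. Qed.

Lemma psum0 x N (g : int -> K) : (forall i : nat, (i < N)%N -> g i = 0) -> psum x N g = 0.
Proof. by move=> g0; apply: big1 => i _; rewrite g0 ?mul0r. Qed.

Lemma psum_widen x N N' (g : int -> K) : (N <= N')%N ->
  (forall i : nat, (N <= i)%N -> g i = 0) -> psum x N' g = psum x N g.
Proof.
move=> le_N g0; rewrite /psum (big_ord_widen N' (fun i => g i%:Z * x ^+ i) le_N).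
rewrite [RHS]big_mkcond; apply: eq_bigr => i _.
by case: ltnP => // /g0 ->; rewrite mul0r.
Qed.

(** Multiplication by x^m lowers the index of the coefficients; the sum over a
    fixed range loses nothing if the support leaves room for the shift. *)
Lemma psum_shift x N (m : nat) (g : int -> K) :
  (forall i, i < 0 -> g i = 0) -> (forall i, N%:Z - m%:Z < i -> g i = 0) ->
  psum x N.+1 (fun i => g (i - m%:Z)) = x ^+ m * psum x N.+1 g.
Proof.
elim: m g => [|m IH] g g_neg g_big.
  by rewrite mul1r; apply: eq_psum => i; rewrite subr0.
transitivity (psum x N.+1 (fun i => g (i - m%:Z - 1))).
  by apply: eq_psum => i; congr g; lia.
rewrite (IH (fun i => g (i - 1))); first last.
- by move=> i i_gt; apply: g_big; lia.
- by move=> i i_lt; apply: g_neg; lia.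
rewrite exprSr -mulrA; congr (_ * _).
rewrite /psum big_ord_recl big_ord_recr /= g_neg // g_big; last by lia.
rewrite !mul0r add0r addr0 mulr_sumr; apply: eq_bigr => i _.
rewrite /bump /= exprS mulrCA; congr (_ * (g _ * _)); lia.
Qed.

Definition triple N (f : int -> int -> int -> K) :=
  psum A N (fun i => psum B N (fun j => psum C N (f i j))).

Lemma eq_triple N f g : (forall i j k, f i j k = g i j k) -> triple N f = triple N g.
Proof. by move=> fg; do 3!(apply: eq_psum => ?). Qed.

Lemma tripleD N f g :
  triple N (fun i j k => f i j k + g i j k) = triple N f + triple N g.
Proof.
rewrite /triple -psumD; apply: eq_psum => i.
by rewrite -psumD; apply: eq_psum => j; rewrite -psumD.
Qed.

Lemma tripleZ N c f : triple N (fun i j k => c * f i j k) = c * triple N f.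
Proof.
rewrite /triple -psumZ; apply: eq_psum => i.
by rewrite -psumZ; apply: eq_psum => j; rewrite -psumZ.
Qed.

Lemma triple_delta N (a b c : nat) : (a < N)%N -> (b < N)%N -> (c < N)%N ->
  triple N (fun i j k => [&& i == a, j == b & k == c]%:R) = A ^+ a * B ^+ b * C ^+ c.
Proof.
move=> aN bN cN.
have psum_delta x m (F : int -> K) : (m < N)%N ->
    (forall i : nat, i != m -> F i = 0) -> psum x N F = F m * x ^+ m.
  move=> mN F0; rewrite /psum (bigD1 (Ordinal mN)) //= big1 ?addr0 // => i ne.
  by rewrite F0 ?mul0r.
rewrite /triple (psum_delta _ a) //; last first.
  move=> i /negbTE i_ne; apply: psum0 => j _; apply: psum0 => k _.
  by rewrite eqz_nat i_ne.
rewrite (psum_delta _ b) //; last first.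
  by move=> j /negbTE j_ne; apply: psum0 => k _; rewrite !eqz_nat j_ne andbF.
rewrite (psum_delta _ c) //; last first.
  by move=> k /negbTE k_ne; rewrite !eqz_nat k_ne !andbF.
by rewrite !eqxx mul1r; ring.
Qed.

Definition triple_sum L := triple L.+1 (summand q L).

(** A summand for a parameter M below L is supported on indices at most M, which
    leaves room for shifts by up to L - M. *)
Lemma triple_summand_shift M L (a b c : nat) g :
  M + a%:Z <= L%:Z -> M + b%:Z <= L%:Z -> M + c%:Z <= L%:Z ->
  (forall i j k, g i j k = summand q M (i - a%:Z) (j - b%:Z) (k - c%:Z)) ->
  triple L.+1 g = A ^+ a * B ^+ b * C ^+ c * triple L.+1 (summand q M).
Proof.
move=> aL bL cL gE; rewrite (eq_triple _ gE) {gE}.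
rewrite /triple; transitivity (A ^+ a * psum A L.+1 (fun i =>
  B ^+ b * psum B L.+1 (fun j => C ^+ c * psum C L.+1 (summand q M i j)))); last first.
  rewrite -!mulrA; congr (_ * _); rewrite -!psumZ; apply: eq_psum => i.
  by congr (_ * _); rewrite -psumZ; apply: eq_psum.
rewrite -psum_shift; first last.
- move=> i i_gt; rewrite [psum B _ _]psum0 ?mulr0 // => j _.
  rewrite psum0 ?mulr0 // => k _.
  by apply: summand_big; lia.
- move=> i i_lt; rewrite [psum B _ _]psum0 ?mulr0 // => j _.
  rewrite psum0 ?mulr0 // => k _.
  by apply: summand_eq0 => //; lia.
apply: eq_psum => i; rewrite -psum_shift; first last.
- by move=> j j_gt; rewrite psum0 ?mulr0 // => k _; apply: summand_big; lia.
- by move=> j j_lt; rewrite psum0 ?mulr0 // => k _; apply: summand_eq0 => //; lia.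
apply: eq_psum => j; rewrite -psum_shift //.
- by move=> k k_lt; apply: summand_eq0 => //; lia.
- by move=> k k_gt; apply: summand_big; lia.
Qed.

(** The range of summation may depend on a larger parameter than the summand, as
    the additional summands vanish. *)
Lemma triple_summand_lag n (m : nat) :
  triple n.+1 (summand q (n%:Z - m%:Z)) = iter m (@lag K) triple_sum n.
Proof.
have lagE G : iter m (@lag K) G n = if (m <= n)%N then G (n - m)%N else 0.
  elim: m n => [|m IH] n; first by rewrite subn0.
  by case: n => [|n] //; rewrite iterS /= IH.
rewrite lagE; case: leqP => [le_m|lt_m]; last first.
  by do 3!(apply: psum0 => ? _); rewrite summand_eq0 //; lia.
rewrite /triple_sum (_ : n%:Z - m%:Z = (n - m)%N); last by lia.
rewrite /triple (@psum_widen _ (n - m).+1); try lia; last first.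
  by move=> i i_gt; do 2!(apply: psum0 => ? _); apply: summand_big; lia.
apply: eq_psum => i; rewrite (@psum_widen _ (n - m).+1); try lia; last first.
  by move=> j j_gt; apply: psum0 => ? _; apply: summand_big; lia.
apply: eq_psum => j; rewrite (@psum_widen _ (n - m).+1) //; try lia.
by move=> k k_gt; apply: summand_big; lia.
Qed.

Lemma triple_sum_fsbig L : triple_sum L =
  \sum_(i \in [set: nat]%classic) \sum_(j \in [set: nat]%classic)
    \sum_(k \in [set: nat]%classic)
     q ^+ (tri i + tri j + tri k) * A ^+ i * B ^+ j * C ^+ k
     * qbinom q (L%:Z - i%:Z) j%:Z
     * qbinom q (L%:Z - j%:Z) k%:Z
     * qbinom q (L%:Z - k%:Z) i%:Z.
Proof.
have fsum (F : nat -> K) : (forall i, (L < i)%N -> F i = 0) ->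
    \sum_(i \in [set: nat]%classic) F i = \sum_(i < L.+1) F i.
  move=> F0; rewrite fsbig_ord; apply/esym/fsbig_widen => // i [_ /negP].
  by rewrite -leqNgt => /F0.
have summandE (i j k : nat) :
    q ^+ (tri i + tri j + tri k) * A ^+ i * B ^+ j * C ^+ k
     * qbinom q (L%:Z - i%:Z) j%:Z
     * qbinom q (L%:Z - j%:Z) k%:Z
     * qbinom q (L%:Z - k%:Z) i%:Z
  = summand q L i j k * C ^+ k * B ^+ j * A ^+ i.
  by rewrite /summand /=; ring.
rewrite fsum; last first.
  move=> i i_gt; apply: fsbig1 => j _; apply: fsbig1 => k _.
  by rewrite summandE summand_big ?mul0r //; lia.
apply: eq_bigr => i _; rewrite fsum; last first.
  move=> j j_gt; apply: fsbig1 => k _.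
  by rewrite summandE summand_big ?mul0r //; lia.
rewrite mulr_suml; apply: eq_bigr => j _; rewrite fsum; last first.
  by move=> k k_gt; rewrite summandE summand_big ?mul0r //; lia.
by rewrite !mulr_suml; apply: eq_bigr => k _; rewrite summandE.
Qed.

Hypotheses (q_neq0 : q != 0) (q_pow_neq1 : forall n, q ^+ n.+1 != 1).

Lemma triple_sum_rec : four_term_rec A B C q triple_sum.
Proof.
move=> n; pose T := fun m : nat => triple n.+1 (summand q (n%:Z - m%:Z)).
have l1 : lag triple_sum n = T 1%N by rewrite /T triple_summand_lag.
have l2 : lag (lag triple_sum) n = T 2%N by rewrite /T triple_summand_lag.
have l3 : lag (lag (lag triple_sum)) n = T 3%N by rewrite /T triple_summand_lag.
have l4 : lag (lag (lag (lag triple_sum))) n = T 4%N.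
  by rewrite /T triple_summand_lag.
have shift (m a b c : nat) (g : int -> int -> int -> K) :
    (a <= m)%N -> (b <= m)%N -> (c <= m)%N ->
    (forall i j k, g i j k = summand q (n%:Z - m%:Z) (i - a%:Z) (j - b%:Z) (k - c%:Z)) ->
    triple n.+1 g = A ^+ a * B ^+ b * C ^+ c * T m.
  by move=> am bm cm; apply: triple_summand_shift; lia.
have d0 : triple n.+1 (fun i j k => [&& n == 0%N, i == 0, j == 0 & k == 0]%:R)
    = impulse K n.
  rewrite /impulse; case: (n == 0%N) => /=.
    by rewrite (@triple_delta _ 0 0 0) // !mulr1.
  by do 3!(apply: psum0 => ? _).
have d2 : triple n.+1 (fun i j k => [&& n == 2%N, i == 1, j == 1 & k == 1]%:R)
    = A * B * C * lag (lag (@impulse K)) n.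
  case: eqVneq => [->|n_ne2] /=.
    by rewrite (@triple_delta _ 1 1 1) // !expr1 mulr1.
  rewrite (_ : lag _ n = 0) ?mulr0; first by do 3!(apply: psum0 => ? _).
  by move: n_ne2; case: (n) => [|[|[|]]].
rewrite [LHS]/triple_sum.
rewrite (eq_triple _ (fun i j k => summand_rec q_neq0 q_pow_neq1 i j k n)) /summand_rhs.
rewrite !(tripleD, tripleZ) d0 d2.
rewrite (shift 1 0 0 0)%N //; last by move=> i j k; congr (summand _ _ _ _ _); lia.
rewrite (shift 1 1 0 0)%N //; last by move=> i j k; congr (summand _ _ _ _ _); lia.
rewrite (shift 1 0 1 0)%N //; last by move=> i j k; congr (summand _ _ _ _ _); lia.
rewrite (shift 1 0 0 1)%N //; last by move=> i j k; congr (summand _ _ _ _ _); lia.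
rewrite (shift 2 1 1 0)%N //; last by move=> i j k; congr (summand _ _ _ _ _); lia.
rewrite (shift 2 1 0 1)%N //; last by move=> i j k; congr (summand _ _ _ _ _); lia.
rewrite (shift 2 0 1 1)%N //; last by move=> i j k; congr (summand _ _ _ _ _); lia.
rewrite (shift 3 1 1 1)%N //.
rewrite (shift 3 2 1 1)%N //; last by move=> i j k; congr (summand _ _ _ _ _); lia.
rewrite (shift 3 1 2 1)%N //; last by move=> i j k; congr (summand _ _ _ _ _); lia.
rewrite (shift 3 1 1 2)%N //; last by move=> i j k; congr (summand _ _ _ _ _); lia.
rewrite (shift 4 2 2 2)%N //; last by move=> i j k; congr (summand _ _ _ _ _); lia.
rewrite l1 l2 l3 l4 -!exprnP.
(* For n = 0 the exponents of the two versions of the recurrence differ, but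
   the lagged values vanish. *)
case: n T l1 l2 l3 l4 {shift d0 d2} => [|n] T l1 l2 l3 l4.
  by rewrite -l1 -l2 -l3 -l4 /=; ring.
have -> : n.+1%:Z * 2 - 1 = (2 * n.+1 - 1)%N by lia.
have -> : n.+1%:Z * 3 - 3 = (3 * n.+1 - 3)%N by lia.
rewrite -!exprnP; move: (q ^+ (2 * n.+1 - 1)) (q ^+ (3 * n.+1 - 3)) => x y.
by ring.
Qed.

End TripleSum.

(** * Indeterminates *)

Lemma varq_neq0 : varq != 0.
Proof. by rewrite tofrac_eq0 -msize_poly_eq0 msizeX. Qed.

Lemma varq_pow_neq1 n : varq ^+ n.+1 != 1.
Proof.
rewrite /varq -tofracXn -tofrac1 tofrac_eq mpolyXn -mpolyX0.
apply/eqP => /(congr1 (fun p : {mpoly int[4]} => msize p)).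
by rewrite !msizeX mdegMn mdeg1 mdeg0 mul1n.
Qed.

Theorem theorem4 (L : nat) :
  \sum_(p \in distinct_partitions_le L)
     weight varA varB varC p * varq ^+ sumn p =
  \sum_(i \in [set: nat]%classic) \sum_(j \in [set: nat]%classic)
    \sum_(k \in [set: nat]%classic)
     varq ^+ (tri i + tri j + tri k) * varA ^+ i * varB ^+ j * varC ^+ k
     * qbinom varq (L%:Z - i%:Z) j%:Z
     * qbinom varq (L%:Z - j%:Z) k%:Z
     * qbinom varq (L%:Z - k%:Z) i%:Z.
Proof.
rewrite -triple_sum_fsbig.
transitivity (partition_sum varA varB varC varq L).
  rewrite /partition_sum [RHS]fsbig_seq ?uniq_partitions_le //; apply: eq_fsbigl.
  apply/seteqP; split=> p /=; rewrite mem_partitions_le.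
    by move=> [-> ->].
  by move=> /andP.
apply: four_term_rec_unique (partition_sum_rec _ _ _ varq_neq0) _ _.
exact: triple_sum_rec varq_neq0 varq_pow_neq1.
Qed.
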